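(* Let $d\ge2$ and $\zeta_d=\log\frac{\mu_d}{\mu_{d-1}}$ (with $\mu_1=1$). For $\rho\in(0,1)$ let $\nu_n(\rho)$ be the number of zeros (with multiplicity) of $A_n^+(a)$ in the annulus $1-\rho\le|a|\le\frac1{1-\rho}$ of the complex $a$-plane. If $\zeta_d<\rho<1$, then \[ 0<1-\frac1\rho\zeta_d\le\liminf_{n\to\infty}\frac1n\nu_n(\rho)\le\limsup_{n\to\infty}\frac1n\nu_n(\rho)\le1, \] and a positive fraction of the partition function zeros of $A_n^+(a)$ are in the annulus $1-\rho<|a|<\frac1{1-\rho}$.
   Context: Let $\mathbb{L}^d$ be the $d$-dimensional hypercubic lattice and $\mathbb{L}^d_+$ the half-lattice of vertices with last coordinate $\ge0$. A positive walk is a self-avoiding walk in $\mathbb{L}^d_+$ starting at the origin; its visits are its vertices other than the origin with last coordinate $0$. $c_n^+(v)$ is the number of positive walks of length $n$ with $v$ visits and $A_n^+(a)=\sum_{v=0}^n c_n^+(v)a^v$. $\mu_d$ and $\mu_{d-1}$ are the growth constants of self-avoiding walks in the $d$- and $(d-1)$-dimensional hypercubic lattices, with the convention $\mu_1=1$. *)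

(* Defs.v *)
From HB Require Import structures.
From mathcomp Require Import all_boot all_order all_algebra.
From mathcomp Require Import all_classical all_reals all_analysis.
From mathcomp Require Import complex.
Set Implicit Arguments. Unset Strict Implicit. Unset Printing Implicit Defensive.
Import Order.TTheory GRing.Theory Num.Theory.
Local Open Scope ring_scope.

Definition vertex (d : nat) := 'rV[int]_d.

Definition step (d : nat) := ('I_d * bool)%type.

Definition step_vec (d : nat) (e : step d) : vertex d :=
  (delta_mx 0 e.1) *~ (if e.2 then 1 else -1).

(* A walk of length n starting at the origin is encoded by its n steps;
   its k-th vertex (0 <= k <= n) is the sum of its first k steps. *)
Definition wpos (d n : nat) (s : n.-tuple (step d)) (k : nat) : vertex d :=
  \sum_(j < n | (j < k)%N) step_vec (tnth s j).

Definition saw (d n : nat) (s : n.-tuple (step d)) : bool :=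
  [forall i : 'I_n.+1, forall j : 'I_n.+1,
     (wpos s i == wpos s j) ==> (i == j)].

(* last coordinate of a vertex is >= 0 / = 0 (for d >= 1 the last
   coordinate is the one with index d-1) *)
Definition last_ge0 (d : nat) (v : vertex d) : bool :=
  [forall i : 'I_d, (i.+1 == d) ==> (0 <= v 0 i)].
Definition last_eq0 (d : nat) (v : vertex d) : bool :=
  [forall i : 'I_d, (i.+1 == d) ==> (v 0 i == 0)].

Definition positive_walk (d n : nat) (s : n.-tuple (step d)) : bool :=
  saw s && [forall k : 'I_n.+1, last_ge0 (wpos s k)].

Definition visits (d n : nat) (s : n.-tuple (step d)) : nat :=
  #|[set k : 'I_n.+1 | (0 < k)%N && last_eq0 (wpos s k)]|.

Definition c_saw (d n : nat) : nat := #|[set s : n.-tuple (step d) | saw s]|.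

Definition cplus (d n v : nat) : nat :=
  #|[set s : n.-tuple (step d) | positive_walk s && (visits s == v)]|.

Definition Aplus (R : rcfType) (d n : nat) : {poly R[i]} :=
  \sum_(v < n.+1) ((cplus d n v)%:R : R[i]) *: 'X^v.

Definition mu (R : realType) (d : nat) : R :=
  if d == 1%N then 1
  else limn (fun n : nat => ((c_saw d n)%:R : R) `^ (n%:R^-1)).

Definition zeta (R : realType) (d : nat) : R := ln (mu R d / mu R d.-1).

(* the zeros (with multiplicity) of a complex polynomial, i.e. a sequence r
   with p = lead_coef p * prod_{z in r} (X - z) *)
Definition zeros (R : rcfType) (p : {poly R[i]}) : seq R[i] :=
  sval (closed_field_poly_normal p).

Definition nu (R : realType) (d n : nat) (rho : R) : nat :=
  count (fun a : R[i] => (1 - rho <= Normc.normc a) && (Normc.normc a <= (1 - rho)^-1))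
        (zeros (Aplus R d n)).

Definition nu_open (R : realType) (d n : nat) (rho : R) : nat :=
  count (fun a : R[i] => (1 - rho < Normc.normc a) && (Normc.normc a < (1 - rho)^-1))
        (zeros (Aplus R d n)).

Definition nu_total (R : realType) (d n : nat) : nat := size (zeros (Aplus R d n)).

(* Main.v *)
(** Let [p] be the polynomial [A_n^+], with zeros [z_1, ..., z_n].  Landau's
    inequality bounds its Mahler measure by [S], the sum of its coefficients;
    hence, if [N] zeros lie outside the open annulus,
    [|p(0)| |lead p| <= S^2 (1 - rho)^N].  Here [lead p >= c_n] in dimension
    [d - 1] (walks inside the hyperplane), [S <= c_n] in dimension [d], and
    [S <= 2 d p(0)], since dropping the last step and prepending an upward one
    produces a walk without visits.  With [1 - rho <= exp (- rho)] this gives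
    [rho N <= log c_n(d) - log c_n(d-1) + log (2 d)], and dividing by [n] the
    right-hand side tends to [zeta_d] because [log c_n] is subadditive. *)

Require Import Defs.
From HB Require Import structures.
From mathcomp Require Import all_boot all_order all_algebra.
From mathcomp Require Import all_classical all_reals all_analysis.
From mathcomp Require Import complex.
From mathcomp Require Import zify ring lra.
Set Implicit Arguments. Unset Strict Implicit. Unset Printing Implicit Defensive.
Import Order.TTheory GRing.Theory Num.Theory.
Import numFieldNormedType.Exports.
Local Open Scope ring_scope.

(** * Zeros of polynomials and the Mahler measure *)

Definition normsq_poly (C : numClosedFieldType) (p : {poly C}) : C :=
  \sum_(i < size p) `|p`_i| ^+ 2.

Lemma normsq_poly_widen (C : numClosedFieldType) (p : {poly C}) (n : nat) :
  (size p <= n)%N -> normsq_poly p = \sum_(i < n) `|p`_i| ^+ 2.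
Proof.
move=> le_pn; rewrite /normsq_poly -(subnKC le_pn) big_split_ord /=.
rewrite [X in _ + X]big1 ?addr0 // => i _.
by rewrite nth_default ?leq_addr // normr0 expr0n.
Qed.

(* Multiplying by [X - z] or by its reciprocal [1 - z^* X] changes each squared
   coefficient by a telescoping amount. *)
Lemma normsq_poly_flip (C : numClosedFieldType) (q : {poly C}) (z : C) :
  normsq_poly (q * ('X - z%:P)) = normsq_poly (q * (1 - z^* *: 'X)).
Proof.
have sz1 : (size (q * ('X - z%:P))%R <= (size q).+1)%N.
  by rewrite (leq_trans (size_polyMleq _ _)) // size_XsubC addn2.
have sz2 : (size (q * (1 - z^* *: 'X))%R <= (size q).+1)%N.
  rewrite (leq_trans (size_polyMleq _ _)) //.
  have : (size (1 - z^* *: 'X : {poly C})%R <= 2)%N.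
    rewrite (leq_trans (size_polyD _ _)) // geq_max size_poly1 /= size_polyN.
    by rewrite (leq_trans (size_scale_leq _ _)) ?size_polyX.
  by move=> h; rewrite -subn1 leq_subLR add1n -addn2 leq_add2l.
rewrite (normsq_poly_widen sz1) (normsq_poly_widen sz2).
apply/eqP; rewrite -subr_eq0 -sumrB.
(* The shift by one matches the product with ['X], and the boolean factor supplies the zero
   coefficient of index -1. In the difference of the two squared moduli the cross terms are
   conjugate and cancel. *)
pose g (k : nat) : C := `|q`_k.-1| ^+ 2 *+ (k != 0%N).
rewrite (eq_bigr (fun i : 'I_(size q).+1 =>
  (1 - `|z| ^+ 2) * (g i - g i.+1))); last first.
  move=> i _; rewrite [q * ('X - _)]mulrBr [q * (1 - _)]mulrBr mulr1.
  rewrite !coefB coefMX coefMC.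
  rewrite -scalerAr coefZ coefMX /g /= mulr1n.
  case: (i : nat) => [|k] /=.
    rewrite mulr0n sub0r mulr0 subr0 normrN normrM; ring.
  rewrite mulr1n !normCK !rmorphB !rmorphM /= conjCK; ring.
rewrite -mulr_sumr; apply/eqP.
have -> : \sum_(i < (size q).+1) (g i - g i.+1) = 0; last by rewrite mulr0.
rewrite -(big_mkord xpredT (fun i => g i - g i.+1)).
rewrite (telescope_sumr_eq (fun k => - g k)) //; last first.
  by move=> k _; rewrite opprK addrC.
by rewrite /g /= nth_default // normr0 expr0n /= mulr0n subrr.
Qed.

Lemma normsq_poly_lead (C : numClosedFieldType) (p : {poly C}) :
  `|lead_coef p| ^+ 2 <= normsq_poly p.
Proof.
have [->|p0] := eqVneq p 0.
  by rewrite lead_coef0 normr0 expr0n sumr_ge0 // => i _; rewrite exprn_ge0.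
rewrite /normsq_poly lead_coefE -(@prednK (size p)) ?lt0n ?size_poly_eq0 //.
by rewrite big_ord_recr /= lerDr sumr_ge0 // => i _; rewrite exprn_ge0.
Qed.

Lemma normsq_poly_le (C : numClosedFieldType) (p : {poly C}) :
  normsq_poly p <= (\sum_(i < size p) `|p`_i|) ^+ 2.
Proof.
rewrite /normsq_poly.
(* Nonnegativity of the partial l1 sum is carried through the induction because the cross term of
   the square needs it. *)
have [] // : 0 <= \sum_(i < size p) `|p`_i| /\
    \sum_(i < size p) `|p`_i| ^+ 2 <= (\sum_(i < size p) `|p`_i|) ^+ 2.
elim/big_rec2: _ => [|i y1 y2 _ [y0 le_y]]; first by rewrite expr0n.
split; first by rewrite addr_ge0.
by rewrite sqrrD -addrA lerD2l ler_wpDl // mulrn_wge0 // mulr_ge0.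
Qed.

(** The cofactor [q] is arbitrary so that the induction can absorb each treated factor into it. *)
Lemma normsq_poly_flips (C : numClosedFieldType) (rs : seq C) (q : {poly C}) :
  normsq_poly (q * \prod_(z <- rs) ('X - z%:P)) =
  normsq_poly
    (q * \prod_(z <- rs) (if 1 < `|z| then 1 - z^* *: 'X else 'X - z%:P)).
Proof.
elim: rs q => [|z rs IH] q; first by rewrite !big_nil.
rewrite !big_cons; case: ifP => _; last by rewrite !mulrA IH.
rewrite [q * (_ * _)]mulrA [q * _ * _]mulrAC normsq_poly_flip mulrAC IH.
by rewrite mulrA.
Qed.

(* Landau's inequality, with the l1 norm in place of the l2 norm. *)
Lemma mahler_measure_le (C : numClosedFieldType) (p : {poly C}) (rs : seq C) :
  p = lead_coef p *: \prod_(z <- rs) ('X - z%:P) ->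
  `|lead_coef p| * \prod_(z <- rs) (if 1 < `|z| then `|z| else 1)
  <= \sum_(i < size p) `|p`_i|.
Proof.
move=> Ep; set M := _ * _.
have M0 : 0 <= M.
  rewrite mulr_ge0 // big_seq_cond prodr_ge0 // => z _; by case: ifP.
rewrite -(@ler_pXn2r _ 2) // ?nnegrE ?sumr_ge0 //.
apply: le_trans (normsq_poly_le _).
rewrite Ep -mul_polyC normsq_poly_flips mul_polyC.
set q := _ *: _.
(* Each reflected factor has leading coefficient [- z^*], of modulus [|z|], while the others stay
   monic; so the Mahler measure becomes a single coefficient. *)
suff -> : M = `|lead_coef q| by exact: normsq_poly_lead.
rewrite /q lead_coefZ lead_coef_prod normrM /M; congr (_ * _).
rewrite normr_prod; apply: eq_bigr => z _.
case: ifP => [z1|_]; last by rewrite lead_coefXsubC normr1.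
have z0 : z^* != 0.
  by rewrite conjC_eq0 -normr_gt0 (lt_trans ltr01).
rewrite lead_coefDr ?size_poly1 ?size_polyN ?size_scale ?size_polyX //.
by rewrite lead_coefN lead_coefZ lead_coefX mulr1 normrN norm_conjC.
Qed.

(** By Vieta the left side is the squared Mahler measure times the product of [|z| / max(1, |z|)^2].
    Each such factor is at most 1, and at most [r] when [z] lies outside the open annulus. *)
Lemma zeros_outside_annulus_le (C : numClosedFieldType) (p : {poly C})
    (rs : seq C) (r : C) :
  p = lead_coef p *: \prod_(z <- rs) ('X - z%:P) -> 0 < r < 1 ->
  `|p`_0| * `|lead_coef p| <=
  (\sum_(i < size p) `|p`_i|) ^+ 2
  * r ^+ count (fun z => ~~ ((r < `|z|) && (`|z| < r^-1))) rs.
Proof.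
move=> Ep /andP[r0 r1].
pose m (z : C) : C := if 1 < `|z| then `|z| else 1.
have m1 z : 1 <= m z by rewrite /m; case: ifP => // /ltW.
have -> : `|p`_0| * `|lead_coef p|
    = (`|lead_coef p| * \prod_(z <- rs) m z) ^+ 2
      * \prod_(z <- rs) (`|z| / m z ^+ 2).
  have -> : `|p`_0| = `|lead_coef p| * \prod_(z <- rs) `|z|.
    rewrite {1}Ep coefZ -horner_coef0 horner_prod normrM normr_prod.
    by congr (_ * _); apply: eq_bigr => z _; rewrite hornerXsubC sub0r normrN.
  have -> : \prod_(z <- rs) `|z|
      = (\prod_(z <- rs) m z) ^+ 2 * \prod_(z <- rs) (`|z| / m z ^+ 2).
    rewrite -prodrXl -big_split; apply: eq_bigr => z _ /=.
    rewrite mulrCA divff ?mulr1 // expf_neq0 // gt_eqF //.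
    exact: lt_le_trans (m1 z).
  ring.
apply: ler_pM.
- by rewrite exprn_ge0 // mulr_ge0 // prodr_ge0 // => z _; apply: le_trans (m1 z).
- by rewrite prodr_ge0 // => z _; rewrite divr_ge0 ?exprn_ge0 // (le_trans _ (m1 z)).
- have S0 : 0 <= `|lead_coef p| * \prod_(z <- rs) m z.
    by rewrite mulr_ge0 // prodr_ge0 // => z _; apply: le_trans (m1 z).
  by apply: lerXn2r; rewrite ?nnegrE ?sumr_ge0 // mahler_measure_le.
elim: rs {Ep} => [|z rs IH]; first by rewrite big_nil.
rewrite big_cons /= exprD ler_pM //.
- by rewrite divr_ge0 ?exprn_ge0 // (le_trans _ (m1 z)).
- by rewrite prodr_ge0 // => y _; rewrite divr_ge0 ?exprn_ge0 // (le_trans _ (m1 y)).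
rewrite negb_and /m.
(* The order on [C] is only partial, so negating a strict inequality requires both sides to be
   real. *)
have reals (x y : C) : 0 < x -> 0 <= y -> ~~ (x < y) = (y <= x).
  by move=> x0 y0; rewrite -real_leNgt ?(ger0_real y0) ?(gtr0_real x0).
have ri0 : 0 < r^-1 by rewrite invr_gt0.
have -> : (~~ (`|z| < r^-1)) = (r^-1 <= `|z|).
  by rewrite -real_leNgt ?normr_real ?(gtr0_real ri0).
rewrite reals //.
case: ifP => [z1|/negbT].
  have z0 : 0 < `|z| by apply: lt_trans z1.
  rewrite expr2 invfM mulrA divff ?gt_eqF // mul1r.
  case: (boolP (_ || _)) => [/orP[h|h]|_].
  - by have := lt_le_trans z1 (le_trans h (ltW r1)); rewrite ltxx.
  - by rewrite expr1 -(invrK r) lef_pV2.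
  - by rewrite expr0 invf_le1 // ltW.
rewrite reals // => z1; rewrite expr1n divr1.
case: (boolP (_ || _)) => [/orP[h|h]|_] //.
by have := le_trans h z1; rewrite invf_le1 // => /le_lt_trans/(_ r1); rewrite ltxx.
Qed.

(** * Counting self-avoiding walks *)

Definition endpoint (d : nat) (w : seq (step d)) : vertex d :=
  \sum_(e <- w) step_vec e.

Lemma endpoint_cat d (w1 w2 : seq (step d)) :
  endpoint (w1 ++ w2) = endpoint w1 + endpoint w2.
Proof. exact: big_cat. Qed.

(** List prefixes are compatible with concatenation, mapping and dropping steps, the operations
    behind all the walk maps below. *)
Lemma wposE d n (s : n.-tuple (step d)) k : wpos s k = endpoint (take k s).
Proof.
rewrite /wpos /endpoint.
(* [nth] needs a default step, which is available only from a nonempty walk. *)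
case: n s => [|n] s.
  by rewrite big_ord0 (tuple0 s) /= big_nil.
case: s => w /= sz.
have x0 : step d by case: w sz => [|e w] //.
have szw := eqP sz.
transitivity (\sum_(j < n.+1 | (j < k)%N) step_vec (nth x0 w j)).
  by apply: eq_bigr => j _; rewrite (tnth_nth x0).
rewrite -(big_mkord (fun j => (j < k)%N) (fun j => step_vec (nth x0 w j))).
rewrite [RHS](big_nth x0) size_take szw.
rewrite [LHS](big_nat_widenl _ 0) // [LHS]big_mkcond /=.
rewrite [RHS](big_nat_widen _ _ n.+1); last by case: ltnP => // /ltnW.
rewrite [RHS]big_mkcond; apply: eq_big_nat => j /andP[_ jn] /=.
have -> : (j < (if (k < n.+1)%N then k else n.+1))%N = (j < k)%N.
  by case: ifP; lia.
by case: ltnP => // jk; rewrite nth_take.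
Qed.

Lemma sawP d n (s : n.-tuple (step d)) :
  reflect (forall i j, (i <= n)%N -> (j <= n)%N ->
             endpoint (take i s) = endpoint (take j s) -> i = j)
          (saw s).
Proof.
apply: (iffP idP) => [/forallP h i j i_n j_n E|h].
  have /forallP/(_ (inord j))/implyP := h (inord i).
  by rewrite !wposE !inordK // E => /(_ (eqxx _))/eqP/(congr1 val); rewrite /= !inordK.
apply/forallP => i; apply/forallP => j; apply/implyP => /eqP; rewrite !wposE => E.
by apply/eqP/val_inj/(h _ _ _ _ E); rewrite -ltnS.
Qed.

Lemma positive_walkP d n (s : n.-tuple (step d.+1)) :
  reflect (saw s /\ forall k, (k <= n)%N -> 0 <= endpoint (take k s) 0 ord_max)
          (positive_walk s).
Proof.
apply: (iffP andP) => -[s_saw h]; split=> //.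
  move=> k kn; have /forallP/(_ ord_max)/implyP := forallP h (inord k).
  by rewrite wposE inordK // => ->.
apply/forallP => k; apply/forallP => i; apply/implyP => /eqP [i_d].
by rewrite wposE (_ : i = ord_max); [rewrite h // -ltnS|exact: val_inj].
Qed.

Lemma last_eq0E d (v : vertex d.+1) : last_eq0 v = (v 0 ord_max == 0).
Proof.
apply/forallP/idP => [/(_ ord_max)|v0 i]; first by rewrite eqxx.
by apply/implyP => /eqP [i_d]; rewrite (_ : i = ord_max) //; exact: val_inj.
Qed.

(** Cutting after [m] steps is injective. The second piece is a translate of the tail of the walk,
    so a repeated vertex in either piece would give one in the whole. *)
Lemma c_saw_submul d m n : (c_saw d (m + n) <= c_saw d m * c_saw d n)%N.
Proof.
rewrite /c_saw -cardsX.
pose f (s : (m + n).-tuple (step d)) : m.-tuple (step d) * n.-tuple (step d) :=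
  (tcast (minn_idPl (leq_addr n m)) [tuple of take m s],
   tcast (addKn m n) [tuple of drop m s]).
have f1 s : (f s).1 = take m s :> seq _ by rewrite val_tcast.
have f2 s : (f s).2 = drop m s :> seq _ by rewrite val_tcast.
have f_inj : injective f.
  move=> s t E; apply: val_inj.
  by rewrite /= -(cat_take_drop m s) -(cat_take_drop m t) -!f1 -!f2 E.
rewrite -(card_imset _ f_inj); apply/subset_leq_card/fintype.subsetP => x.
case/imsetP => s; rewrite inE => /sawP s_saw ->{x}; rewrite !inE.
apply/andP; split; apply/sawP => i j i_n j_n.
  by rewrite !f1 !take_takel // => E; apply: s_saw => //; lia.
rewrite !f2 => E; apply: (@addnI m); apply: s_saw; rewrite ?leq_add2l //.
by rewrite !takeD !endpoint_cat E.
Qed.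

Lemma endpoint_nseq d (e : step d) k : endpoint (nseq k e) = step_vec e *+ k.
Proof. by rewrite /endpoint big_nseq -Monoid.iteropE. Qed.

Lemma c_saw_gt0 d n : (0 < c_saw d.+1 n)%N.
Proof.
apply/card_gt0P; exists [tuple of nseq n (ord0, true)]; rewrite inE.
apply/sawP => i j i_n j_n /=; rewrite !take_nseq // !endpoint_nseq.
move=> /matrixP/(_ 0 0); rewrite /step_vec /= mulr1z !mulmxnE !mxE !eqxx /=.
by move=> /eqP; rewrite eqr_nat => /eqP.
Qed.

Definition n_positive_walks (d n : nat) : nat :=
  #|[set s : n.-tuple (step d) | positive_walk s]|.

Lemma sum_cplus d n : (\sum_(v < n.+1) cplus d n v = n_positive_walks d n)%N.
Proof.
(* Index 0 never counts as a visit, so at most [n] of the [n.+1] indices do, and no walk is lost in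
   the sum. *)
have visits_le (s : n.-tuple (step d)) : (visits s <= n)%N.
  rewrite -ltnS -[X in (_ < X)%N](card_ord n.+1) -cardsT; apply: proper_card.
  by rewrite properT; apply/eqP => /setP/(_ ord0); rewrite !inE.
rewrite /n_positive_walks -sum1_card.
rewrite (partition_big (fun s => inord (visits s) : 'I_n.+1) xpredT) //=.
apply: eq_bigr => v _; rewrite /cplus -sum1_card; apply: eq_bigl => s.
rewrite !inE; congr (_ && _); apply/eqP/eqP => [->|<-]; first by rewrite inord_val.
by rewrite inordK ?ltnS.
Qed.

Lemma n_positive_walks_le d n : (n_positive_walks d n <= c_saw d n)%N.
Proof.
by apply/subset_leq_card/fintype.subsetP => s; rewrite !inE => /andP[].
Qed.

(* Dropping the last step and prepending an upward one turns a positive walk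
   into a positive walk of the same length without visits. *)
Lemma n_positive_walks_le_cplus0 d n :
  (n_positive_walks d.+1 n.+1 <= (d.+1).*2 * cplus d.+1 n.+1 0)%N.
Proof.
have -> : (d.+1).*2 = #|[set: step d.+1]|.
  by rewrite cardsT card_prod card_ord card_bool muln2.
rewrite /n_positive_walks /cplus -cardsX.
pose up : step d.+1 := (ord_max, true).
(* Recording the dropped last step makes the map injective; the number of its possible values is the
   factor in the bound. *)
pose f (s : n.+1.-tuple (step d.+1)) : step d.+1 * n.+1.-tuple (step d.+1) :=
  (last up s, [tuple of up :: belast (thead s) (behead s)]).
have fE (s : n.+1.-tuple (step d.+1)) :
    exists w, [/\ size w = n, s = rcons w (f s).1 :> seq _ &
                (f s).2 = up :: w :> seq _].
  case: s => -[|e w] //= sz; exists (belast e w); split.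
  - by rewrite size_belast; case/eqP: sz.
  - by rewrite -lastI.
  - by [].
have f_inj : injective f.
  move=> s t E; have [w [_ Es Ew]] := fE s; have [w' [_ Et Ew']] := fE t.
  by apply: val_inj; rewrite /= Es Et E; congr rcons; move: Ew; rewrite E Ew' => -[].
rewrite -(card_imset _ f_inj); apply/subset_leq_card/fintype.subsetP => x.
case/imsetP => s; rewrite inE => /positive_walkP[/sawP s_saw s_pos] ->{x}.
have [w [szw Es Ef]] := fE s.
have take_s k : (k <= n)%N -> take k s = take k w.
  by move=> kn; rewrite Es -cats1 takel_cat ?szw.
have up_last : step_vec up 0 ord_max = 1.
  by rewrite /step_vec mulr1z mxE !eqxx.
have endS k : (k <= n)%N ->
    endpoint (take k.+1 (f s).2) = step_vec up + endpoint (take k s).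
  by move=> kn; rewrite Ef /= take_s // /endpoint big_cons.
(* Strict positivity after the first step rules out both a return to the origin and any visit. *)
have lastS k : (k <= n)%N -> 0 < endpoint (take k.+1 (f s).2) 0 ord_max.
  by move=> kn; rewrite endS // mxE up_last ltr_wpDr // s_pos // ltnW.
have end0 : endpoint (take 0 (f s).2) = 0 by rewrite take0 /endpoint big_nil.
rewrite finset.in_setX finset.in_setT inE andTb; apply/andP; split.
  apply/positive_walkP; split; last first.
    by move=> [_|k kn]; [rewrite end0 mxE | exact/ltW/lastS].
  apply/sawP => -[|i] [|j] // i_n j_n.
  - by rewrite end0 => E; have := lastS _ j_n; rewrite -E mxE ltxx.
  - by rewrite end0 => E; have := lastS _ i_n; rewrite E mxE ltxx.
  - by rewrite !endS // => /addrI/s_saw -> //; rewrite ltnW.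
rewrite /visits cards_eq0; apply/eqP/setP => -[[|k] kn]; rewrite !inE //=.
by rewrite last_eq0E wposE gt_eqF // lastS.
Qed.

(** A walk embedded in the boundary hyperplane stays at height 0, so each of its vertices after the
    start is a visit. *)
Lemma c_saw_le_cplus d n : (c_saw d n <= cplus d.+1 n n)%N.
Proof.
pose g (e : step d) : step d.+1 := (widen_ord (leqnSn d) e.1, e.2).
have g_inj : injective g.
  by move=> [i b] [j c] [E ->]; congr (_, _); apply: val_inj.
pose f (s : n.-tuple (step d)) := [tuple of map g s].
have f_inj : injective f.
  by move=> s t /(congr1 val)/(inj_map g_inj) E; apply: val_inj.
have g_last e : step_vec (g e) 0 ord_max = 0.
  have neq : (ord_max == widen_ord (leqnSn d) e.1) = false.
    by apply/negbTE; rewrite neq_ltn orbC /= ltn_ord.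
  by rewrite /step_vec; case: (g e).2; rewrite ?mulrN1z !mxE eqxx /= ?neq ?oppr0.
have g_init e i : step_vec (g e) 0 (widen_ord (leqnSn d) i) = step_vec e 0 i.
  by rewrite /step_vec /=; case: e.2; rewrite ?mulrN1z !mxE.
have end_last w : endpoint (map g w) 0 ord_max = 0.
  by rewrite /endpoint big_map summxE big1.
have end_init w i :
    endpoint (map g w) 0 (widen_ord (leqnSn d) i) = endpoint w 0 i.
  by rewrite /endpoint big_map !summxE; apply: eq_bigr => e _.
rewrite /c_saw /cplus -(card_imset _ f_inj).
apply/subset_leq_card/fintype.subsetP => x.
case/imsetP => s; rewrite inE => /sawP s_saw ->{x}; rewrite inE.
apply/andP; split.
  apply/positive_walkP; split; last first.
    by move=> k kn; rewrite /= -map_take end_last.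
  apply/sawP => i j i_n j_n; rewrite /= -!map_take => E; apply: s_saw => //.
  by apply/rowP => k; rewrite -!end_init E.
have -> : visits (f s) = #|[set~ ord0 : 'I_n.+1]|.
  apply: eq_card => k; rewrite !inE last_eq0E wposE /= -map_take end_last eqxx.
  by rewrite andbT lt0n.
by rewrite cardsC1 card_ord.
Qed.

(** * Growth constants *)

Lemma limn_esup_le (R : realType) (u : nat -> R) (l : R) :
  (\forall n \near \oo%classic, u n <= l) ->
  (limn_esup (fun n => (u n)%:E) <= l%:E)%E.
Proof.
move=> ul; apply: (@le_trans _ _
  (ereal_sup [set (u n)%:E | n in [set n | u n <= l]]%classic)).
  by apply: ereal_inf_lbound; exists [set n | u n <= l]%classic.
by apply: ge_ereal_sup => _ [n /= un <-]; rewrite lee_fin.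
Qed.

(** The liminf is minus the limsup of [- u], which is eventually at most [- l + e] for every
    positive [e]. *)
Lemma limn_einf_ge (R : realType) (u v : nat -> R) (l : R) :
  (\forall n \near \oo%classic, v n <= u n) ->
  (v x @[x --> \oo] --> l)%classic ->
  (l%:E <= limn_einf (fun n => (u n)%:E))%E.
Proof.
move=> vu /cvgrPdist_le vl.
rewrite /limn_einf leeNr; apply/lee_addgt0Pr => e e0.
rewrite -EFinN -EFinD; apply: (@limn_esup_le _ (fun n => - u n)).
near=> n.
have h1 : v n <= u n by near: n.
have : `|l - v n| <= e by near: n; exact: vl.
rewrite ler_norml => /andP[_ h2]; lra.
Unshelve. all: by end_near. Qed.

(** The limit is the infimum of the ratios [a n / n] over positive [n]. A near-minimal ratio at
    [m.+1] controls all large [n] through division of [n] by [m.+1]. *)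
Lemma fekete (R : realType) (a : nat -> R) :
  (forall n, 0 <= a n) -> (forall m n, a (m + n)%N <= a m + a n) ->
  cvgn (fun n => a n / n%:R).
Proof.
move=> a0 aD.
pose E := [set a n.+1 / n.+1%:R | n in [set: nat]]%classic.
have Elb : has_lbound E by exists 0 => _ [n _ <-]; rewrite divr_ge0.
have Einf : has_inf E by split=> //; exists (a 1%N / 1%:R), 0%N.
apply/cvg_ex; exists (inf E); apply/cvgrPdist_le => e e0.
have [|_ [m _ <-] am] := inf_adherent _ Einf (eps := e / 2); first by rewrite divr_gt0.
have aM q r : a (q * m.+1 + r)%N <= q%:R * a m.+1 + a r.
  elim: q => [|q IH]; first by rewrite mul0n add0n mul0r add0r.
  rewrite mulSn -addnA (le_trans (aD _ _)) // -natr1 mulrDl mul1r.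
  by rewrite [q%:R * _ + _]addrC -addrA lerD2l.
(* A bound on [a] at every possible remainder; it contributes less than [e / 2] once divided by a
   large [n]. *)
pose B := \sum_(r < m.+1) a r.
have aB r : (r < m.+1)%N -> a r <= B.
  by move=> rm; rewrite /B (bigD1 (Ordinal rm)) //= lerDl sumr_ge0.
near=> n.
have n0 : (0 < n)%N by near: n; exists 1%N.
have nR : 0 < n%:R :> R by rewrite ltr0n.
have nB : B / (e / 2) < n%:R by near: n; exact: nbhs_infty_gtr.
have lo : inf E <= a n / n%:R.
  by apply: ge_inf => //; exists n.-1 => //; rewrite prednK.
suff hi : a n / n%:R <= a m.+1 / m.+1%:R + e / 2.
  rewrite distrC ger0_norm ?subr_ge0 // lerBlDl (le_trans hi) //.
  by rewrite [in leRHS](splitr e) addrA lerD2r ltW.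
rewrite ler_pdivrMr // [in a n](divn_eq n m.+1).
apply: (le_trans (aM _ _)); rewrite mulrDl lerD //.
  rewrite mulrAC ler_pdivlMr ?ltr0n // mulrAC mulrC ler_wpM2l //.
  by rewrite -natrM ler_nat leq_divM.
rewrite ltr_pdivrMr ?divr_gt0 // in nB.
by rewrite (le_trans (aB _ _)) ?ltn_mod // mulrC ltW.
Unshelve. all: by end_near. Qed.

(** Since [mu] is defined by [limn], it is meaningful only once the sequence is known to converge.
    Fekete's lemma applied to the logarithms gives this, and continuity of [expR] identifies the
    limit. *)
Lemma c_saw_growth (R : realType) (d : nat) :
  0 < mu R d.+2 /\
  ((ln ((c_saw d.+2 n)%:R : R) / n%:R) @[n --> \oo] --> ln (mu R d.+2))%classic.
Proof.
have c0 n : 0 < (c_saw d.+2 n)%:R :> R by rewrite ltr0n c_saw_gt0.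
have : cvgn (fun n => ln ((c_saw d.+2 n)%:R : R) / n%:R).
  apply: fekete => [n|m n]; first by rewrite ln_ge0 // ler1n c_saw_gt0.
  rewrite -lnM ?posrE // ler_ln ?posrE ?mulr_gt0 // -natrM ler_nat.
  exact: c_saw_submul.
move=> /cvg_ex[l cl].
suff -> : mu R d.+2 = expR l by rewrite expRK expR_gt0.
rewrite /mu /=; apply: cvg_lim => //.
rewrite (_ : (fun n => _) = expR \o (fun n => ln ((c_saw d.+2 n)%:R : R) / n%:R)).
  by apply: continuous_cvg => //; exact: continuous_expR.
by apply/funext => n /=; rewrite /powR gt_eqF // mulrC.
Qed.

(* For [d = 0] the convention [mu_1 = 1] makes the trivial minorant [0] do. *)
Lemma ln_c_saw_minorant (R : realType) (d : nat) :
  0 < mu R d.+1 /\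
  exists2 b : nat -> R,
    forall n, b n <= ln ((c_saw d.+1 n)%:R : R) / n%:R
    & (b x @[x --> \oo] --> ln (mu R d.+1))%classic.
Proof.
case: d => [|d]; last first.
  have [mu0 cvg_c] := c_saw_growth R d; split=> //.
  by exists (fun n => ln ((c_saw d.+2 n)%:R : R) / n%:R).
split; first by rewrite /mu.
exists (fun=> 0) => [n|]; first by rewrite divr_ge0 // ln_ge0 // ler1n c_saw_gt0.
by rewrite /mu /= ln1; exact: cvg_cst.
Qed.

(** * Zeros of the partition function *)

Lemma coef_Aplus (R : rcfType) (d n i : nat) : (i <= n)%N ->
  (Aplus R d n)`_i = (cplus d n i)%:R.
Proof.
move=> i_n; rewrite /Aplus -(poly_def n.+1 (fun v => (cplus d n v)%:R)).
by rewrite coef_poly ltnS i_n.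
Qed.

(** The top coefficient is nonzero because of the walks inside the hyperplane; hence there are
    exactly [n] zeros. *)
Lemma size_Aplus (R : rcfType) (d n : nat) : size (Aplus R d.+2 n) = n.+1.
Proof.
rewrite /Aplus -(poly_def n.+1 (fun v => (cplus d.+2 n v)%:R)) size_poly_eq //=.
by rewrite pnatr_eq0 -lt0n (leq_trans (c_saw_gt0 d n)) // c_saw_le_cplus.
Qed.

Lemma nu_totalE (R : realType) (d n : nat) : nu_total R d.+2 n = n.
Proof.
rewrite /nu_total /zeros; case: closed_field_poly_normal => rs /= E.
have := size_Aplus R d n; rewrite {1}E size_scale ?size_prod_XsubC => [[]//|].
by rewrite lead_coef_eq0 -size_poly_eq0 size_Aplus.
Qed.

Lemma c_saw_le_nu_open (R : realType) (d n : nat) (rho : R) :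
  0 < rho < 1 ->
  (c_saw d.+1 n.+1)%:R <=
  (d.+2).*2%:R * (c_saw d.+2 n.+1)%:R
  * (1 - rho) ^+ (n.+1 - nu_open d.+2 n.+1 rho) :> R.
Proof.
move=> /andP[rho0 rho1].
have := nu_totalE R d n.+1; rewrite /nu_open /nu_total /zeros.
set p := Aplus _ _ _; case: closed_field_poly_normal => rs /= Ep sz_rs.
set inside := (fun a : R[i] => _).
have r01 : (0 : R[i]) < ((1 - rho)%:C)%C < 1.
  by rewrite !ltcR subr_gt0 rho1 ltrBlDr ltrDl.
have := zeros_outside_annulus_le Ep r01.
have sz_p : size p = n.+2 by exact: size_Aplus.
rewrite lead_coefE sz_p /= !coef_Aplus // !normr_nat.
have -> : \sum_(i < n.+2) `|p`_i| = (n_positive_walks d.+2 n.+1)%:R.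
  rewrite -sum_cplus natr_sum; apply: eq_bigr => i _.
  by rewrite coef_Aplus ?normr_nat // -ltnS.
rewrite (eq_count (a2 := predC inside)); last first.
  move=> z /=; rewrite /inside; congr (~~ (_ && _)).
    by rewrite -ltcR.
  by rewrite -ltcR fmorphV.
have -> : count (predC inside) rs = (n.+1 - count inside rs)%N.
  by rewrite -sz_rs -(count_predC inside rs) addKn.
set N := (_ - _)%N => le_C.
(* All quantities are real, so the inequality descends from [R[i]] to [R]. *)
have : (cplus d.+2 n.+1 0)%:R * (cplus d.+2 n.+1 n.+1)%:R
    <= (n_positive_walks d.+2 n.+1)%:R ^+ 2 * (1 - rho) ^+ N :> R.
  by rewrite -lecR !rmorphM !rmorphXn /= !rmorph_nat.
set S := (n_positive_walks _ _)%:R; set c0 := (cplus _ _ 0)%:R => le_S.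
have leS0 : S <= (d.+2).*2%:R * c0.
  by rewrite -natrM ler_nat n_positive_walks_le_cplus0.
have S_c : S <= (c_saw d.+2 n.+1)%:R by rewrite ler_nat n_positive_walks_le.
have c_lead : (c_saw d.+1 n.+1)%:R <= (cplus d.+2 n.+1 n.+1)%:R :> R.
  by rewrite ler_nat c_saw_le_cplus.
have lead0 : 0 < (cplus d.+2 n.+1 n.+1)%:R :> R.
  by rewrite ltr0n (leq_trans (c_saw_gt0 d n.+1)) // c_saw_le_cplus.
have S0 : 0 < S.
  apply: lt_le_trans lead0 _; rewrite ler_nat -sum_cplus.
  by rewrite (bigD1 ord_max) //= leq_addr.
have c00 : 0 < c0 by have := lt_le_trans S0 leS0; rewrite pmulr_rgt0 // ltr0n.
have rN : 0 <= (1 - rho) ^+ N by rewrite exprn_ge0 // subr_ge0 ltW.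
(* One factor [S] is bounded through [c0], which then cancels; the other is bounded by the count of
   all self-avoiding walks. *)
apply: le_trans c_lead _; rewrite -(ler_pM2l c00) (le_trans le_S) //.
rewrite !mulrA ler_wpM2r // expr2 mulrC [c0 * _]mulrC.
by apply: ler_pM => //; exact: ltW.
Qed.

Lemma nu_open_le_nu (R : realType) (d n : nat) (rho : R) :
  (nu_open d n rho <= nu d n rho)%N.
Proof. by apply: sub_count => z /andP[h1 h2]; rewrite !ltW. Qed.

Lemma nu_le (R : realType) (d n : nat) (rho : R) : (nu d.+2 n rho <= n)%N.
Proof. by rewrite -{2}(nu_totalE R d n) count_size. Qed.

Lemma nu_open_ge (R : realType) (d n : nat) (rho : R) :
  0 < rho < 1 ->
  1 - rho^-1 * (ln (d.+2).*2%:R * n.+1%:R^-1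
                + ln ((c_saw d.+2 n.+1)%:R : R) / n.+1%:R
                - ln ((c_saw d.+1 n.+1)%:R : R) / n.+1%:R)
  <= (nu_open d.+2 n.+1 rho)%:R / n.+1%:R.
Proof.
move=> rho01; have := c_saw_le_nu_open d n rho01.
have /andP[rho0 rho1] := rho01.
have le_n := leq_trans (nu_open_le_nu d.+2 n.+1 rho) (nu_le d n.+1 rho).
set N := (n.+1 - _)%N => le_c.
have -> : (nu_open d.+2 n.+1 rho)%:R = n.+1%:R - N%:R :> R.
  by rewrite /N natrB // opprB addrC subrK.
have c1 k : 0 < (c_saw d.+1 k)%:R :> R by rewrite ltr0n c_saw_gt0.
have c2 k : 0 < (c_saw d.+2 k)%:R :> R by rewrite ltr0n c_saw_gt0.
(* This replaces [- ln (1 - rho)] by the smaller [rho], which yields the constant of the theorem. *)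
have le_e : (1 - rho) ^+ N <= expR (- (rho * N%:R)).
  rewrite -mulNr expRM_natr lerXn2r ?nnegrE ?expR_ge0 ?expR_ge1Dx //.
  by rewrite subr_ge0 ltW.
have : ln ((c_saw d.+1 n.+1)%:R : R)
    <= ln (d.+2).*2%:R + ln ((c_saw d.+2 n.+1)%:R : R) - rho * N%:R.
  have d0 : 0 < (d.+2).*2%:R :> R by rewrite ltr0n.
  rewrite -[X in _ <= _ + X]expRK -!lnM ?posrE ?mulr_gt0 ?expR_gt0 //.
  rewrite ler_ln ?posrE ?mulr_gt0 ?expR_gt0 //.
  by apply: (le_trans le_c); rewrite ler_wpM2l // mulr_ge0 ?ltW.
set L2 := ln _; set L1 := ln _; set L0 := ln _ => le_L.
have n0 : 0 < n.+1%:R :> R by rewrite ltr0n.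
rewrite -!mulrDl -mulrBl [(n.+1%:R - N%:R) / _]mulrBl divff ?gt_eqF //.
rewrite lerD2l lerN2 mulrA ler_pM2r ?invr_gt0 //.
by rewrite ler_pdivlMl // lerBrDr addrC -lerBrDr.
Qed.

Theorem theorem2p6 (R : realType) (d : nat) (rho : R) :
  (2 <= d)%N -> 0 < rho -> zeta R d < rho -> rho < 1 ->
  [/\ (0 < 1 - rho^-1 * zeta R d)%R,
      ((1 - rho^-1 * zeta R d)%:E
         <= limn_einf (fun n : nat => ((nu d n rho)%:R / n%:R : R)%:E))%E,
      (limn_einf (fun n : nat => ((nu d n rho)%:R / n%:R : R)%:E)
         <= limn_esup (fun n : nat => ((nu d n rho)%:R / n%:R : R)%:E))%E,
      (limn_esup (fun n : nat => ((nu d n rho)%:R / n%:R : R)%:E) <= 1%:E)%E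
    & (0 < limn_einf (fun n : nat =>
             ((nu_open d n rho)%:R / (nu_total R d n)%:R : R)%:E))%E].
Proof.
case: d => [|[|d]] // _ rho0 lt_zeta rho1.
have rho01 : 0 < rho < 1 by rewrite rho0.
have pos : 0 < 1 - rho^-1 * zeta R d.+2.
  by rewrite subr_gt0 ltr_pdivrMl // mulr1.
have [mu1 [b b_le cvg_b]] := ln_c_saw_minorant R d.
have [mu2 cvg_c] := c_saw_growth R d.
(* The lower-dimensional logarithm enters the bound with a positive sign, so the minorant [b] may
   replace it and make the bound convergent. *)
pose v n : R := 1 - rho^-1 * (ln (d.+2).*2%:R * n%:R^-1
                + ln ((c_saw d.+2 n)%:R : R) / n%:R - b n).
have cvg_v : (v x @[x --> \oo] --> 1 - rho^-1 * zeta R d.+2)%classic.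
  have cvg_inv : ((n%:R^-1 : R) @[n --> \oo] --> (0 : R))%classic.
    by rewrite -cvg_shiftS; exact: cvg_harmonic.
  rewrite /zeta ln_div ?posrE //=.
  apply: cvgB; first exact: cvg_cst.
  apply: cvgMl_tmp; apply: cvgB => //; rewrite -[ln (mu R d.+2)]add0r.
  apply: cvgD => //; rewrite -(mulr0 (ln (d.+2).*2%:R : R)).
  exact: cvgMl_tmp.
have v_le : \forall n \near \oo%classic, v n <= (nu_open d.+2 n rho)%:R / n%:R.
  exists 1%N => // -[//|n] _ /=; apply: le_trans (nu_open_ge d n rho01).
  by rewrite /v lerD2l lerN2 ler_pM2l ?invr_gt0 // lerD2l lerN2 b_le.
split=> //.
- apply: limn_einf_ge cvg_v; apply: filterS v_le => n /le_trans; apply.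
  by rewrite ler_wpM2r ?invr_ge0 // ler_nat nu_open_le_nu.
- exact: limn_einf_sup.
- apply: limn_esup_le; exists 1%N => // -[//|n] _ /=.
  by rewrite ler_pdivrMr ?ltr0n // mul1r ler_nat nu_le.
(* The minorant [v] already bounds the open count, and the total number of zeros is [n], so the same
   positive constant works. *)
- apply: (@lt_le_trans _ _ (1 - rho^-1 * zeta R d.+2)%:E).
    by rewrite lte_fin.
  apply: limn_einf_ge cvg_v; apply: filterS v_le => n.
  by rewrite nu_totalE.
Qed.
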